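(* Let $\mathbb G=(\mathsf A,u)$ be a PW-quantum group of dimension $3$ related to the array $E$, with modular constants $M_n=\sum_{j,k}|E_{njk}|^2$, $n=1,2,3$. Then for all $a,b,k,s\in\{1,2,3\}$ the generators of $\mathbb G$ satisfy $$\sum_{s=1}^3M_su_{sa}u_{sb}^*=\delta_{ab}M_a1_{\mathsf A},\qquad \sum_{i=1}^3\frac1{M_i}u_{ki}^*u_{si}=\frac1{M_k}\delta_{ks}1_{\mathsf A}.$$
   Context: PW-quantum groups: let $E=[E_{i_1i_2i_3}]_{i_1,i_2,i_3=1}^3$ be an array of complex numbers, normalized by $E_{123}=1$, with $E_{i_1i_2i_3}\neq0$ if and only if $(i_1,i_2,i_3)$ is a permutation of $(1,2,3)$. The PW-quantum group related to $E$ is $(\mathsf A,u)$, where $\mathsf A$ is the universal unital C$^*$-algebra generated by the entries of $u=[u_{jk}]_{j,k=1}^3$ subject to $\sum_{s}u_{js}u_{ks}^*=\delta_{jk}1=\sum_s u_{sj}^*u_{sk}$ and $\sum_{i_1,i_2,i_3}E_{i_1i_2i_3}u_{a_1i_1}u_{a_2i_2}u_{a_3i_3}=E_{a_1a_2a_3}1$ for all $a_1,a_2,a_3$, with comultiplication $\Delta(u_{jk})=\sum_s u_{js}\otimes u_{sk}$; it is a compact quantum group by the Woronowicz construction. *)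

(* Defs.v *)
From HB Require Import structures.
From mathcomp Require Import all_boot all_order all_algebra.
From mathcomp Require Import complex.
From mathcomp Require Import all_classical all_reals all_analysis.
Set Implicit Arguments.
Unset Strict Implicit.
Unset Printing Implicit Defensive.
Import Order.TTheory GRing.Theory Num.Theory.
Import numFieldNormedType.Exports.
Local Open Scope classical_set_scope.
Local Open Scope ring_scope.

(* Unital C*-algebras.  The norm is a field of its own, with values in [R],
   because the library has no join of normed modules and noncommutative rings.
   An [algType] has [1 != 0], so the zero algebra is excluded; this does not
   affect the universal property below, since there is exactly one map into the
   zero algebra and the scalar algebra already satisfies the relations (by
   [u = 1]). *)
HB.mixin Record isCStar (R : realType) A of GRing.Algebra R[i] A := {
  star : A -> A;
  starK : involutive star;
  starD : {morph star : x y / x + y};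
  starZ : forall (c : R[i]) (x : A), star (c *: x) = c^* *: star x;
  starM : forall x y : A, star (x * y) = star y * star x;
  cnorm : A -> R;
  cnormD : forall x y : A, cnorm (x + y) <= cnorm x + cnorm y;
  cnormZ : forall (c : R[i]) (x : A), cnorm (c *: x) = complex.Re `|c| * cnorm x;
  cnorm_eq0 : forall x : A, cnorm x = 0 -> x = 0;
  cnormM : forall x y : A, cnorm (x * y) <= cnorm x * cnorm y;
  cnorm_starM : forall x : A, cnorm (star x * x) = cnorm x ^+ 2;
  cnorm_complete : forall x : nat -> A,
    (forall e : R, 0 < e -> exists N : nat, forall m n : nat,
       (N <= m)%N -> (N <= n)%N -> cnorm (x m - x n) < e) ->
    exists l : A, cnorm (x n - l) @[n --> \oo] --> 0
}.

#[short(type="cstarType")]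
HB.structure Definition CStar (R : realType) :=
  {A of GRing.Algebra R[i] A & isCStar R A}.

Definition norm_closed (R : realType) (A : cstarType R) (D : set A) : Prop :=
  forall (x : nat -> A) (l : A), (forall n, D (x n)) ->
    cnorm (x n - l) @[n --> \oo] --> 0 -> D l.

Definition star_morphism (R : realType) (A B : cstarType R) (f : A -> B)
    : Prop :=
  [/\ linear f, monoid_morphism f & {morph f : x / star x}].

(* [S] generates [A] as a unital C*-algebra. *)
Definition generates (R : realType) (A : cstarType R) (S : set A) : Prop :=
  forall D : set A,
    norm_closed D ->
    D 1 ->
    (forall (c : R[i]) (x y : A), D x -> D y -> D (c *: x + y)) ->
    (forall x y : A, D x -> D y -> D (x * y)) ->
    (forall x : A, D x -> D (star x)) ->
    S `<=` D -> D = setT.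

(* [x ⊗ y |-> i1 x * i2 y] is a faithful *-homomorphism on the algebraic
   tensor product of [A] and [B].  Faithfulness is stated on tensors
   [\sum_k x_k ⊗ y_k] with linearly independent [x_k], which vanish in the
   algebraic tensor product only if all [y_k] do. *)
Definition tensor_embedding (R : realType) (A B T : cstarType R)
    (i1 : A -> T) (i2 : B -> T) : Prop :=
  [/\ star_morphism i1, star_morphism i2,
      forall x y, i1 x * i2 y = i2 y * i1 x
    & forall (n : nat) (x : 'I_n -> A) (y : 'I_n -> B),
        (forall c : 'I_n -> R[i],
           \sum_k c k *: x k = 0 -> forall k, c k = 0) ->
        \sum_k i1 (x k) * i2 (y k) = 0 -> forall k, y k = 0].

(* [T] is the minimal (spatial) C*-tensor product of [A] and [B]: a completion
   of the algebraic tensor product for its least C*-norm. *)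
Definition min_tensor (R : realType) (A B T : cstarType R)
    (i1 : A -> T) (i2 : B -> T) : Prop :=
  [/\ tensor_embedding i1 i2,
      generates (range i1 `|` range i2)
    & forall (S : cstarType R) (j1 : A -> S) (j2 : B -> S),
        tensor_embedding j1 j2 ->
        forall (n : nat) (x : 'I_n -> A) (y : 'I_n -> B),
          cnorm (\sum_k i1 (x k) * i2 (y k)) <=
          cnorm (\sum_k j1 (x k) * j2 (y k))].

(* The indices 1, 2, 3 are the elements 0, 1, 2 of ['I_3]. *)
Definition PW_array (R : realType) (E : 'I_3 -> 'I_3 -> 'I_3 -> R[i]) : Prop :=
  E 0 1 2%:R = 1 /\
  forall i1 i2 i3 : 'I_3,
    E i1 i2 i3 <> 0 <->
    perm_eq [:: i1; i2; i3] [:: 0; 1; 2%:R].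

Definition modular_constant (R : realType) (E : 'I_3 -> 'I_3 -> 'I_3 -> R[i])
    (n : 'I_3) : R[i] :=
  \sum_j \sum_k `|E n j k| ^+ 2.

Definition PW_relations (R : realType) (E : 'I_3 -> 'I_3 -> 'I_3 -> R[i])
    (A : cstarType R) (u : 'M[A]_3) : Prop :=
  [/\ forall j k, \sum_s u j s * star (u k s) = (j == k)%:R,
      forall j k, \sum_s star (u s j) * u s k = (j == k)%:R
    & forall a1 a2 a3,
        \sum_i1 \sum_i2 \sum_i3
          E i1 i2 i3 *: (u a1 i1 * u a2 i2 * u a3 i3) = (E a1 a2 a3)%:A].

(* The comultiplication is valued in any model [pw_tensor] of the minimal tensor
   square, with legs [pw_left x = x ⊗ 1] and [pw_right y = 1 ⊗ y]. *)
Record PW_quantum_group (R : realType) (E : 'I_3 -> 'I_3 -> 'I_3 -> R[i]) := {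
  pw_alg :> cstarType R;
  pw_gen : 'M[pw_alg]_3;
  pw_rel : PW_relations E pw_gen;
  pw_generates : generates [set x | exists j k, x = pw_gen j k];
  pw_universal : forall (B : cstarType R) (v : 'M[B]_3),
    PW_relations E v ->
    exists! f : pw_alg -> B,
      star_morphism f /\ forall j k, f (pw_gen j k) = v j k;
  pw_tensor : cstarType R;
  pw_left : pw_alg -> pw_tensor;
  pw_right : pw_alg -> pw_tensor;
  pw_min_tensor : min_tensor pw_left pw_right;
  pw_comul : pw_alg -> pw_tensor;
  pw_comul_morphism : star_morphism pw_comul;
  pw_comul_gen : forall j k,
    pw_comul (pw_gen j k) =
    \sum_s pw_left (pw_gen j s) * pw_right (pw_gen s k)
}.

(* Main.v *)
Require Import Defs.
From mathcomp Require Import all_boot all_order all_algebra.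
From mathcomp Require Import complex.
From mathcomp Require Import all_classical all_reals all_analysis.
Set Implicit Arguments.
Unset Strict Implicit.
Unset Printing Implicit Defensive.
Import Order.TTheory GRing.Theory Num.Theory.
Import numFieldNormedType.Exports.
Local Open Scope ring_scope.

(** Read the array [E] in two ways as a scalar matrix from one leg to the other
    two: [T] with entries [E k i j] in row [(i, j)] and column [k], and [S] with
    entries [E i j k] in the same position.  Write [W] for the tensor square of
    [u], which is unitary like [u], and [v] for the entrywise adjoint of [u].
    Cancelling the first factor of [u] in the defining cubic relation gives
    [T v = W T]; cancelling the first two gives [W^* S = S v^*].  Since an
    intertwiner of an isometry with [v] makes its Gram matrix invariant
    ([intertwiner_gram]), this yields

      [v^* D v = D]  and  [v N v^* = N],  with  [D = T^* T], [N = S^* S].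

    The support condition on [E] makes both Gram matrices diagonal with
    positive entries, and [D] is the diagonal matrix of the modular constants.
    The first equation is the first claimed identity, and says that
    [D^-1 v^* D] is a left inverse of [v].  The second equation provides a right
    inverse of [v].  The two coincide, so [v D^-1 v^* = D^-1]
    ([inverse_invariance]), which is the second claimed identity. *)

(** * Matrices over a C*-algebra *)

Lemma star1 (R : realType) (A : cstarType R) : star (1 : A) = 1.
Proof. by rewrite -[LHS]mulr1 -[X in _ * X]starK -starM mulr1 starK. Qed.

Lemma star0 (R : realType) (A : cstarType R) : star (0 : A) = 0.
Proof. by apply: (addrI (star 0)); rewrite -starD !addr0. Qed.

Lemma star_sum (R : realType) (A : cstarType R) (I : finType) (F : I -> A) :
  star (\sum_i F i) = \sum_i star (F i).
Proof. by apply: big_morph; [exact: starD | exact: star0]. Qed.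

Lemma star_alg (R : realType) (A : cstarType R) (c : R[i]) :
  star (c%:A : A) = c^*%:A.
Proof. by rewrite starZ star1. Qed.

Definition adjmx (R : realType) (A : cstarType R) m n (X : 'M[A]_(m, n)) :
  'M[A]_(n, m) := map_mx star X^T.

Definition scalars (R : realType) (A : cstarType R) m n
  (F : 'M[R[i]]_(m, n)) : 'M[A]_(m, n) := map_mx (in_alg A) F.

Definition conj_trmx (R : realType) m n (F : 'M[R[i]]_(m, n)) :
  'M[R[i]]_(n, m) := map_mx Num.conj F^T.

Lemma adjmxK (R : realType) (A : cstarType R) m n (X : 'M[A]_(m, n)) :
  adjmx (adjmx X) = X.
Proof. by apply/matrixP => i j; rewrite !mxE starK. Qed.

Lemma adjmxM (R : realType) (A : cstarType R) m n p
  (X : 'M[A]_(m, n)) (Y : 'M[A]_(n, p)) :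
  adjmx (X *m Y) = adjmx Y *m adjmx X.
Proof.
apply/matrixP => i j; rewrite !mxE star_sum; apply: eq_bigr => k _.
by rewrite !mxE starM.
Qed.

Lemma adjmx_scalars (R : realType) (A : cstarType R) m n
  (F : 'M[R[i]]_(m, n)) :
  adjmx (scalars A F) = scalars A (conj_trmx F).
Proof. by apply/matrixP => i j; rewrite !mxE /= star_alg. Qed.

(** Transposition does not reverse products of matrices with noncommuting
    entries; it does when one factor has central entries. *)
Lemma trmx_mul_scalars (R : realType) (A : cstarType R) m n p
  (X : 'M[A]_(m, n)) (F : 'M[R[i]]_(n, p)) :
  (X *m scalars A F)^T = scalars A F^T *m X^T.
Proof.
apply/matrixP => i j; rewrite !mxE; apply: eq_bigr => k _.
by rewrite !mxE /= mulr_algl mulr_algr.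
Qed.

Lemma intertwiner_gram (R : realType) (A : cstarType R) m n
  (W : 'M[A]_m) (v : 'M[A]_n) (T : 'M[A]_(m, n)) :
  adjmx W *m W = 1%:M -> T *m v = W *m T ->
  adjmx v *m (adjmx T *m T) *m v = adjmx T *m T.
Proof.
move=> WW TvWT; rewrite mulmxA -adjmxM -mulmxA TvWT adjmxM.
by rewrite -mulmxA [adjmx W *m _]mulmxA WW mul1mx.
Qed.

(** The left inverse [D^-1 v^* D] and the right inverse [N v^* N^-1] of [v]
    must be equal; [D'] and [N'] play the roles of [D^-1] and [N^-1]. *)
Lemma inverse_invariance (R : realType) (A : cstarType R) n
  (v D D' N N' : 'M[A]_n) :
  D' *m D = 1%:M -> D *m D' = 1%:M -> N *m N' = 1%:M ->
  adjmx v *m D *m v = D -> v *m N *m adjmx v = N ->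
  v *m D' *m adjmx v = D'.
Proof.
move=> D'D DD' NN' vDv vNv.
have right_inv : v *m (N *m adjmx v *m N') = 1%:M.
  by rewrite !mulmxA vNv.
have left_inv : (D' *m adjmx v *m D) *m v = 1%:M.
  by rewrite -!mulmxA [adjmx v *m _]mulmxA vDv.
have inv_eq : N *m adjmx v *m N' = D' *m adjmx v *m D.
  by rewrite -[LHS]mul1mx -left_inv -mulmxA right_inv mulmx1.
rewrite inv_eq in right_inv.
by rewrite -[LHS]mulmx1 -DD' !mulmxA -[RHS]mul1mx -right_inv !mulmxA.
Qed.

(** * The tensor square of a unitary matrix *)

(** Rows and columns of the tensor square are numbered by an enumeration of the
    pairs of indices. *)
Definition pair_dim n := #|{: 'I_n * 'I_n}|.

Definition tensor_square (R : realType) (A : cstarType R) n (u : 'M[A]_n) :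
  'M[A]_(pair_dim n) :=
  \matrix_(p, q) (u (enum_val p).1 (enum_val q).1 *
                  u (enum_val p).2 (enum_val q).2).

Lemma sum_pair_dim (V : nmodType) n (F : 'I_n -> 'I_n -> V) :
  \sum_(p < pair_dim n) F (enum_val p).1 (enum_val p).2 =
  \sum_i \sum_j F i j.
Proof.
by rewrite pair_bigA -(big_enum_val (fun x => F x.1 x.2)).
Qed.

Lemma tensor_square_isometry (R : realType) (A : cstarType R) n (u : 'M[A]_n) :
  adjmx u *m u = 1%:M ->
  adjmx (tensor_square u) *m tensor_square u = 1%:M.
Proof.
move=> uu; have uuE i j : \sum_s star (u s i) * u s j = (i == j)%:R.
  move/matrixP/(_ i j): uu; rewrite !mxE => <-.
  by apply: eq_bigr => s _; rewrite !mxE.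
apply/matrixP => p q; rewrite !mxE -(inj_eq enum_val_inj).
transitivity (\sum_i \sum_j star (u i (enum_val p).1 * u j (enum_val p).2) *
                (u i (enum_val q).1 * u j (enum_val q).2)).
  by rewrite -sum_pair_dim; apply: eq_bigr => k _; rewrite !mxE.
case: (enum_val p) (enum_val q) => p1 p2 [q1 q2] /=.
(* The two copies of the first factor of the tensor square meet in the middle,
   so they have to be summed first. *)
rewrite exchange_big /= xpair_eqE.
transitivity (\sum_j star (u j p2) * (p1 == q1)%:R * u j q2).
  apply: eq_bigr => j _; rewrite -uuE big_distrr big_distrl /=.
  by apply: eq_bigr => i _; rewrite starM !mulrA.
case: (p1 == q1); last by rewrite big1 // => j _; rewrite mulr0 mul0r.
by rewrite -uuE; apply: eq_bigr => j _; rewrite mulr1.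
Qed.

Lemma tensor_square_coisometry (R : realType) (A : cstarType R) n
  (u : 'M[A]_n) :
  u *m adjmx u = 1%:M ->
  tensor_square u *m adjmx (tensor_square u) = 1%:M.
Proof.
move=> uu; have uuE i j : \sum_s u i s * star (u j s) = (i == j)%:R.
  move/matrixP/(_ i j): uu; rewrite !mxE => <-.
  by apply: eq_bigr => s _; rewrite !mxE.
apply/matrixP => p q; rewrite !mxE -(inj_eq enum_val_inj).
transitivity (\sum_i \sum_j u (enum_val p).1 i * u (enum_val p).2 j *
                star (u (enum_val q).1 i * u (enum_val q).2 j)).
  by rewrite -sum_pair_dim; apply: eq_bigr => k _; rewrite !mxE.
case: (enum_val p) (enum_val q) => p1 p2 [q1 q2] /=.
rewrite xpair_eqE.
transitivity (\sum_i u p1 i * (p2 == q2)%:R * star (u q1 i)).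
  apply: eq_bigr => i _; rewrite -uuE big_distrr big_distrl /=.
  by apply: eq_bigr => j _; rewrite starM !mulrA.
rewrite andbC; case: (p2 == q2).
  by rewrite -uuE; apply: eq_bigr => j _; rewrite mulr1.
by rewrite big1 // => j _; rewrite mulr0 mul0r.
Qed.

(** * The array as an intertwiner *)

Definition first_leg (C : Type) n (E : 'I_n -> 'I_n -> 'I_n -> C) :
  'M[C]_(pair_dim n, n) :=
  \matrix_(p, k) E k (enum_val p).1 (enum_val p).2.

Definition last_leg (C : Type) n (E : 'I_n -> 'I_n -> 'I_n -> C) :
  'M[C]_(pair_dim n, n) :=
  \matrix_(p, k) E (enum_val p).1 (enum_val p).2 k.

Definition cubic_relation (R : realType) (A : cstarType R) n
  (E : 'I_n -> 'I_n -> 'I_n -> R[i]) (u : 'M[A]_n) : Prop :=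
  forall a1 a2 a3,
    \sum_i1 \sum_i2 \sum_i3
      E i1 i2 i3 *: (u a1 i1 * u a2 i2 * u a3 i3) = (E a1 a2 a3)%:A.

(** The factor of [u] acting on the first leg of [E] stands leftmost in the
    cubic relation, so the left inverse [u^*] cancels it. *)
Lemma first_leg_intertwiner (R : realType) (A : cstarType R) n
  (E : 'I_n -> 'I_n -> 'I_n -> R[i]) (u : 'M[A]_n) :
  adjmx u *m u = 1%:M -> cubic_relation E u ->
  scalars A (first_leg E) *m map_mx star u =
  tensor_square u *m scalars A (first_leg E).
Proof.
move=> uu cub; set T := first_leg E.
have cubT : u *m (tensor_square u *m scalars A T)^T = scalars A T^T.
  apply/matrixP => c p; rewrite !mxE /= -cub; apply: eq_bigr => k _.
  rewrite !mxE big_distrr /= -sum_pair_dim; apply: eq_bigr => q _.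
  by rewrite !mxE /= mulr_algr -!scalerAr mulrA.
apply: trmx_inj; rewrite -[RHS]mul1mx -uu -mulmxA cubT.
by rewrite -[RHS]trmxK trmx_mul_scalars !map_trmx !trmxK.
Qed.

(** The two factors of [u] acting on the first two legs of [E] form the tensor
    square, whose adjoint cancels them in the cubic relation. *)
Lemma last_leg_intertwiner (R : realType) (A : cstarType R) n
  (E : 'I_n -> 'I_n -> 'I_n -> R[i]) (u : 'M[A]_n) :
  adjmx u *m u = 1%:M -> cubic_relation E u ->
  scalars A (last_leg E) *m u^T =
  adjmx (tensor_square u) *m scalars A (last_leg E).
Proof.
move=> uu cub; set S := last_leg E.
have cubS : tensor_square u *m (scalars A S *m u^T) = scalars A S.
  apply/matrixP => p c; rewrite !mxE /= -cub -sum_pair_dim.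
  apply: eq_bigr => q _; rewrite !mxE big_distrr /=.
  apply: eq_bigr => k _.
  by rewrite !mxE /= mulr_algl -!scalerAr.
by rewrite -{2}cubS mulmxA tensor_square_isometry // mul1mx.
Qed.

(** * Gram matrices of the array *)

(** Columns with disjoint supports are orthogonal. *)
Lemma gram_diag (R : realType) m n (F : 'M[R[i]]_(m, n)) :
  (forall p i j, F p i != 0 -> F p j != 0 -> i = j) ->
  conj_trmx F *m F = diag_mx (\row_k \sum_p `|F p k| ^+ 2).
Proof.
move=> supp; apply/matrixP => i j; rewrite !mxE.
have [<-|neq_ij] := eqVneq i j.
  by rewrite mulr1n; apply: eq_bigr => p _; rewrite !mxE normCKC.
rewrite big1 // => p _; rewrite !mxE.
have [->|Fi] := eqVneq (F p i) 0; first by rewrite conjC0 mul0r.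
have [->|Fj] := eqVneq (F p j) 0; first by rewrite mulr0.
by move: neq_ij; rewrite (supp p i j Fi Fj) eqxx.
Qed.

Lemma sum_sqr_norm_neq0 (R : realType) m (f : 'I_m -> R[i]) :
  (exists p, f p != 0) -> \sum_p `|f p| ^+ 2 != 0.
Proof.
case=> p0 fp0; rewrite psumr_neq0; last by move=> p _; rewrite exprn_ge0.
by apply/hasP; exists p0; rewrite ?mem_index_enum //= exprn_gt0 ?normr_gt0.
Qed.

Lemma scalars_diag_inv (R : realType) (A : cstarType R) n
  (d : 'rV[R[i]]_n) : (forall k, d 0 k != 0) ->
  scalars A (diag_mx d) *m scalars A (diag_mx (map_mx GRing.inv d)) = 1%:M /\
  scalars A (diag_mx (map_mx GRing.inv d)) *m scalars A (diag_mx d) = 1%:M.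
Proof.
move=> d_neq0; rewrite /scalars -!map_mxM !mulmx_diag.
split; rewrite -[RHS](map_mx1 (in_alg A)); congr map_mx;
  apply/matrixP => i j; rewrite !mxE; congr (_ *+ _).
  by rewrite divff.
by rewrite mulVf.
Qed.

(** Two entries of a permutation of the three indices determine the third. *)
Lemma PW_array_support (R : realType) (E : 'I_3 -> 'I_3 -> 'I_3 -> R[i]) :
  PW_array E ->
  (forall p i j, first_leg E p i != 0 -> first_leg E p j != 0 -> i = j) /\
  (forall p i j, last_leg E p i != 0 -> last_leg E p j != 0 -> i = j).
Proof.
case=> _ supp; have perm1 (i j : 'I_3) : perm_eq [:: i] [:: j] -> i = j.
  by move=> /perm_mem/(_ i); rewrite !inE eqxx => /esym/eqP.
split=> p i j; rewrite !mxE;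
  case: (enum_val p) => a b /= /eqP/supp perm_i /eqP/supp perm_j; apply: perm1.
  by rewrite -(perm_cat2r [:: a; b]) (perm_trans perm_i) // perm_sym.
by rewrite -(perm_cat2l [:: a; b]) (perm_trans perm_i) // perm_sym.
Qed.

Lemma PW_array_legs_neq0 (R : realType) (E : 'I_3 -> 'I_3 -> 'I_3 -> R[i]) :
  PW_array E ->
  (forall k, exists p, first_leg E p k != 0) /\
  (forall k, exists p, last_leg E p k != 0).
Proof.
(* The two indices other than [k] are [k + 1] and [k + 2] modulo 3. *)
case=> _ supp; split=> k; exists (enum_rank (k + 1, k + 2%:R));
  by rewrite mxE enum_rankK; apply/eqP/supp; case: k => [[|[|[|]]]].
Qed.

Theorem theorem3p3 (R : realType) (E : 'I_3 -> 'I_3 -> 'I_3 -> R[i])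
    (hE : PW_array E) (G : PW_quantum_group E) :
  let u := pw_gen G in
  let M := modular_constant E in
  (forall a b : 'I_3,
     \sum_s M s *: (u s a * star (u s b)) = ((a == b)%:R * M a)%:A) /\
  (forall k s : 'I_3,
     \sum_i (M i)^-1 *: (star (u k i) * u s i) = ((M k)^-1 * (k == s)%:R)%:A).
Proof.
move=> u M; have [uuV uVu cub] := pw_rel G.
have {uuV} uuV : u *m adjmx u = 1%:M.
  apply/matrixP => i j; rewrite !mxE -uuV.
  by apply: eq_bigr => s _; rewrite !mxE.
have {uVu} uVu : adjmx u *m u = 1%:M.
  apply/matrixP => i j; rewrite !mxE -uVu.
  by apply: eq_bigr => s _; rewrite !mxE.
have [supp1 supp3] := PW_array_support hE.
have [neq1 neq3] := PW_array_legs_neq0 hE.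
set v := map_mx star u.
have adj_v : adjmx v = u^T by apply/matrixP => i j; rewrite !mxE starK.
have M_norms k : \sum_p `|first_leg E p k| ^+ 2 = M k.
  rewrite /M /modular_constant -sum_pair_dim.
  by apply: eq_bigr => p _; rewrite mxE.
set d := \row_k \sum_p `|first_leg E p k| ^+ 2.
set e := \row_k \sum_p `|last_leg E p k| ^+ 2.
have d_neq0 k : d 0 k != 0 by rewrite mxE sum_sqr_norm_neq0.
have e_neq0 k : e 0 k != 0 by rewrite mxE sum_sqr_norm_neq0.
have vDv : adjmx v *m scalars (pw_alg G) (diag_mx d) *m v =
           scalars (pw_alg G) (diag_mx d).
  rewrite -gram_diag // /scalars map_mxM -!/(scalars _ _) -adjmx_scalars.
  apply: intertwiner_gram (tensor_square_isometry uVu) _.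
  exact: first_leg_intertwiner.
(* Here the intertwined isometry is the adjoint of the tensor square. *)
have vNv : v *m scalars (pw_alg G) (diag_mx e) *m adjmx v =
           scalars (pw_alg G) (diag_mx e).
  rewrite -gram_diag // /scalars map_mxM -!/(scalars _ _) -adjmx_scalars.
  rewrite -{1}[v]adjmxK.
  apply: (@intertwiner_gram _ _ _ _ (adjmx (tensor_square u))).
    by rewrite adjmxK tensor_square_coisometry.
  by rewrite adj_v last_leg_intertwiner.
have [dK Kd] := scalars_diag_inv (pw_alg G) d_neq0.
have [eK _] := scalars_diag_inv (pw_alg G) e_neq0.
have vDVv := inverse_invariance Kd dK eK vDv vNv.
split=> [a b|k s].
  move/matrixP/(_ a b): vDv; rewrite /scalars map_diag_mx -mulmxA.
  rewrite mul_diag_mx adj_v !mxE M_norms mulr_natl -scalerMnl => <-.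
  apply: eq_bigr => s _; rewrite !mxE M_norms.
  by rewrite /= mulr_algl scalerAr.
move/matrixP/(_ k s): vDVv; rewrite /scalars map_diag_mx -mulmxA.
rewrite mul_diag_mx adj_v !mxE M_norms mulr_natr -scalerMnl => <-.
apply: eq_bigr => i _; rewrite !mxE M_norms.
by rewrite /= mulr_algl scalerAr.
Qed.
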